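(* Let $k$ be a field of characteristic zero and let $m,r$ be integers with $0\leq r\leq m-2$. Let $f=\det \mathcal{H}_m[r]\in R=k[x_1,\ldots,x_{2m-r-1}]$. Then the Hessian $h(f)$ of $f$ does not vanish, i.e., $h(f)\neq 0$ in $R$.
   Context: $\mathcal{H}_m[r]$ denotes the $m\times m$ matrix whose $(i,j)$ entry is the variable $x_{i+j-1}$ if $i+j\leq 2m-r$ and $0$ if $i+j>2m-r$ (so $r$ is the number of zeros in the last column; $r=0$ is the generic square Hankel matrix). Its ground ring is the polynomial ring $R=k[x_1,\ldots,x_{2m-r-1}]$. The Hessian of $f\in R$ is $h(f)=\det\left(\frac{\partial^2 f}{\partial x_i\partial x_j}\right)_{1\leq i,j\leq 2m-r-1}$. *)

(* Defs.v *)
From mathcomp Require Export all_boot all_algebra.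
From mathcomp Require Export mpoly.

Set Implicit Arguments.
Unset Strict Implicit.
Unset Printing Implicit Defensive.

Import GRing.Theory.
Local Open Scope ring_scope.

(* Indices are 0-based: ordinals i, j stand for row i+1 and column j+1, and   *)
(* the ordinal l stands for the variable x_(l+1). Hence x_((i+1)+(j+1)-1) is  *)
(* 'X_(i + j), and (i+1)+(j+1) <= 2m-r reads i + j < 2m-r-1, which is exactly *)
(* the condition for i + j to be the index of a variable (insub succeeds).    *)
(* The subtractions are truncated; for r < m they agree with those in Z.      *)
Definition hankel (k : comNzRingType) (m r : nat) :
    'M[{mpoly k[2 * m - r - 1]}]_m :=
  \matrix_(i < m, j < m)
    if (insub (i + j)%N : option 'I_(2 * m - r - 1)) is Some l
    then 'X_l else 0.

Definition hessian (k : comNzRingType) (n : nat) (f : {mpoly k[n]}) :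
    {mpoly k[n]} :=
  \det (\matrix_(i < n, j < n) mderiv i (mderiv j f)).

(* Main.v *)
Require Import Defs.
From mathcomp Require Import zify ring.

(**
Put q = r + 1, s = m - q and p = m + s, so that p is the number of variables
and s, q > 0. Reading the variables backwards as the coefficients of a truncated
power series f, the Hankel matrix becomes a block of the lower triangular p x p
Toeplitz matrix T f. We evaluate the Hessian at the point f = 1/h, where
h = 1 + X^q + X^m. If L is the operator "divide by X^m and drop the negative
powers", then L (T h) L = L, and the inverse N of the Hankel matrix at 1/h is a
block of T h (1 - L (T h)).

By Jacobi's formula det A * d_i d_j (det A) = d_i (det A) d_j (det A) -
tr (A_i adj A A_j adj A), where A_i = d_i A is constant. Hence, by Euler's
identity, a vector in the kernel of the Hessian at 1/h gives a Hankel matrix W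
with tr (A_i N W N) = 0 for all i. If w is the series of W, traces can be
computed in the p x p Toeplitz matrices: testing against X^b/h^2 gives
  p [b = 0] w_0 - 2 s (h w)_(m - b) + c_b (h^2 w)_(2 m - b) = 0   (b < p),
where coefficients of negative index are 0, c_m = s, c_b > 0 for q < b < p and
c_b = 0 for b <= q. This system forces w = 0.
*)

Import GRing.Theory.
Local Open Scope ring_scope.

(** * Second derivatives of a determinant *)

Section Derivation.

Variables (R : comNzRingType) (D : {additive R -> R}).
Hypothesis DM : forall x y, D (x * y) = D x * y + x * D y.

Lemma derivation_prod (I : eqType) (r : seq I) (F : I -> R) : uniq r ->
  D (\prod_(j <- r) F j) =
  \sum_(i <- r) \prod_(j <- r) (if j == i then D (F j) else F j).
Proof.
elim: r => [|x r IHr] /= => [_|/andP[xr ur]].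
  (* The Leibniz rule at [1 * 1] forces [D 1 = 0]. *)
  rewrite !big_nil; apply: (addrI (D 1)).
  by rewrite addr0 -[RHS](congr1 D (mulr1 1)) DM mulr1 mul1r.
rewrite !big_cons DM IHr // eqxx; congr (_ * _ + _).
  apply: eq_big_seq => j jr; case: eqP => // jx; by rewrite jx (negPf xr) in jr.
rewrite mulr_sumr; apply: eq_big_seq => i ir; rewrite big_cons.
by case: eqP => // xi; rewrite xi ir in xr.
Qed.

(** Jacobi's formula: the Leibniz rule differentiates one row at a time, and Laplace expansion along
    that row produces the cofactors. *)
Lemma derivation_det (m : nat) (A : 'M[R]_m) :
  D (\det A) = \tr (map_mx D A *m \adj A).
Proof.
transitivity (\sum_i \det (\matrix_(a, b) (if a == i then D (A a b) else A a b))).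
  rewrite /determinant raddf_sum exchange_big /=; apply: eq_bigr => s _.
  rewrite -mulr_sumr; have DN (b : bool) x : D ((-1) ^+ b * x) = (-1) ^+ b * D x.
    by case: b; rewrite ?expr0 ?expr1 ?mul1r ?mulN1r ?raddfN.
  rewrite DN; congr (_ * _); rewrite derivation_prod ?index_enum_uniq //.
  by apply: eq_bigr => i _; apply: eq_bigr => j _; rewrite mxE.
apply: eq_bigr => i _; rewrite (expand_det_row _ i) mxE.
apply: eq_bigr => j _; rewrite !mxE eqxx; congr (_ * (_ * \det _)).
by apply/matrixP=> a b; rewrite !mxE eq_sym (negPf (neq_lift _ _)).
Qed.

Lemma derivation_mulmx (m n p : nat) (A : 'M[R]_(m, n)) (B : 'M[R]_(n, p)) :
  map_mx D (A *m B) = map_mx D A *m B + A *m map_mx D B.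
Proof.
apply/matrixP=> i j; rewrite !mxE raddf_sum -big_split /=.
by apply: eq_bigr => l _; rewrite !mxE DM.
Qed.

Lemma derivation_trace (m : nat) (A : 'M[R]_m) : D (\tr A) = \tr (map_mx D A).
Proof. by rewrite raddf_sum; apply: eq_bigr => i _; rewrite mxE. Qed.

(* Differentiating [A *m \adj A = \det A] and multiplying by [\adj A]. *)
Lemma derivation_adj (m : nat) (A : 'M[R]_m) :
  \det A *: map_mx D (\adj A) =
  D (\det A) *: \adj A - \adj A *m map_mx D A *m \adj A.
Proof.
have := congr1 (fun M => \adj A *m map_mx D M) (mul_mx_adj A).
rewrite derivation_mulmx mulmxDr !mulmxA mul_adj_mx mul_scalar_mx.
have -> : map_mx D (\det A)%:M = (D (\det A))%:M :> 'M_m.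
  by apply/matrixP=> i j; rewrite !mxE raddfMn.
by rewrite mul_mx_scalar => <-; rewrite addrC addKr.
Qed.

End Derivation.

(** The factor [\det A] replaces inverting [A]: it allows [derivation_adj] to be applied after
    differentiating Jacobi's formula. *)
Lemma det_second_derivation (R : comNzRingType) (D1 D2 : {additive R -> R})
    (D1M : forall x y, D1 (x * y) = D1 x * y + x * D1 y)
    (D2M : forall x y, D2 (x * y) = D2 x * y + x * D2 y)
    (m : nat) (A : 'M[R]_m) (A12 : map_mx D1 (map_mx D2 A) = 0) :
  \det A * D1 (D2 (\det A)) =
  D1 (\det A) * D2 (\det A)
  - \tr (map_mx D2 A *m \adj A *m map_mx D1 A *m \adj A).
Proof.
rewrite {1}(derivation_det _ _ D2M) derivation_trace (derivation_mulmx _ _ D1M).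
rewrite A12 mul0mx add0r -mxtraceZ scalemxAr (derivation_adj _ _ D1M).
by rewrite mulmxBr raddfB /= -scalemxAr mxtraceZ -derivation_det // !mulmxA.
Qed.

(* Pairing [i] with the point [v] itself gives [m t = t] for [t = \tr (W *m N)],
   where [W := \sum_l w l *: B l]; hence [t = 0]. *)
Lemma hessian_form_kernel (k : fieldType) (hk : [pchar k] =i pred0) (m p : nat)
    (B : 'I_p -> 'M[k]_m) (H : 'M[k]_p) (N : 'M[k]_m) (v w : 'I_p -> k) :
  let A := \sum_l v l *: B l in
  A *m N = 1%:M -> (1 < m)%N ->
  (forall i j, \det A * H i j = \tr (B i *m \adj A) * \tr (B j *m \adj A)
     - \tr (B i *m \adj A *m B j *m \adj A)) ->
  (forall i, \sum_j H i j * w j = 0) ->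
  forall i, \tr (B i *m N *m (\sum_l w l *: B l) *m N) = 0.
Proof.
move=> A AN m1 HB Hw; set W := \sum_l w l *: B l.
have dA0 : \det A != 0.
  apply/eqP=> d0; have := congr1 determinant AN.
  by rewrite det_mulmx d0 mul0r det1 => /eqP; rewrite eq_sym oner_eq0.
have adjN : \adj A = \det A *: N.
  by rewrite -[LHS]mulmx1 -AN mulmxA mul_adj_mx mul_scalar_mx.
have trS (F : 'I_p -> 'M[k]_m) : \tr (\sum_l F l) = \sum_l \tr (F l).
  exact: raddf_sum.
(* This is the [i]-th kernel equation with the nonzero factor [\det A] cancelled. *)
have key i : \tr (B i *m N) * \tr (W *m N) = \tr (B i *m N *m W *m N).
  have HN j : H i j = \det A * (\tr (B i *m N) * \tr (B j *m N)
      - \tr (B i *m N *m B j *m N)).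
    apply: (mulfI dA0); rewrite HB adjN.
    by rewrite -!scalemxAr -!scalemxAl !mxtraceZ; ring.
  have /eqP := Hw i; under eq_bigr do rewrite HN -mulrA.
  rewrite -mulr_sumr mulf_eq0 (negPf dA0) /= => /eqP S0.
  apply/eqP; rewrite -subr_eq0 -S0 /W; apply/eqP.
  rewrite mulmx_suml trS mulr_sumr mulmx_sumr mulmx_suml trS.
  rewrite -sumrB; apply: eq_bigr => j _.
  by rewrite -scalemxAl -scalemxAr -scalemxAl !mxtraceZ; ring.
clearbody W; suff W0 : \tr (W *m N) = 0 by move=> i; rewrite -key W0 mulr0.
have : \tr (A *m N) * \tr (W *m N) = \tr (A *m N *m W *m N).
  rewrite !mulmx_suml !trS mulr_suml; apply: eq_bigr => i _.
  by rewrite /= -!scalemxAl !mxtraceZ -key mulrA.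
rewrite AN mul1mx mxtrace1 => /eqP; rewrite -subr_eq0 -{2}[\tr _]mul1r -mulrBl.
(* Characteristic zero and [1 < m] make the factor [m - 1] nonzero. *)
have -> : m%:R - 1 = (m - 1)%:R :> k by rewrite natrB // ltnW.
by rewrite mulf_eq0 (pcharf0P k).1 // subn_eq0 leqNgt m1 => /eqP.
Qed.

(** * Truncated Toeplitz matrices *)

Section Toeplitz.

Variable k : comNzRingType.
Implicit Types f g : {poly k}.

(** The matrix of multiplication by [f] on [k[X]/(X^p)] in the basis of monomials. *)
Definition toep (p : nat) f : 'M[k]_p :=
  \matrix_(i, j) if (j <= i)%N then f`_(i - j) else 0.

Lemma toepM p f g : toep p (f * g) = toep p f *m toep p g.
Proof.
apply/matrixP=> i j; rewrite !mxE.
under [RHS]eq_bigr => l _ do rewrite !mxE.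
case: leqP => [ji|ij]; last first.
  rewrite big1 // => l _; case: (leqP l i) => li; case: (leqP j l) => jl.
  - by have := leq_trans jl li; rewrite leqNgt ij.
  - by rewrite mulr0.
  - by rewrite mul0r.
  - by rewrite mul0r.
rewrite coefMr -(big_mkord xpredT (fun l => f`_(i - j - l) * g`_l)).
rewrite -(big_mkord xpredT (fun l => (if (l <= i)%N then f`_(i - l) else 0) *
  (if (j <= l)%N then g`_(l - j) else 0))).
rewrite (big_cat_nat (leq0n j) (ltnW (ltn_ord j))) /=.
rewrite [X in _ = X + _]big_nat_cond [X in _ = X + _]big1 ?add0r; last first.
  by move=> l; rewrite andbT => /andP[_ lj] /=; rewrite [(j <= l)%N]leqNgt lj mulr0.
rewrite (@big_cat_nat _ _ _ i.+1 j p) ?ltn_ord ?(leq_trans ji) //=.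
rewrite [X in _ = _ + X]big_nat_cond [X in _ = _ + X]big1 ?addr0; last first.
  by move=> l; rewrite andbT => /andP[il _] /=; rewrite [(l <= i)%N]leqNgt il mul0r.
rewrite [RHS](@big_addn _ _ _ 0 i.+1 j) subSn // big_nat [RHS]big_nat.
apply: eq_bigr => l /andP[_]; rewrite ltnS => lij.
have -> : (l + j <= i)%N by rewrite addnC -leq_subRL.
by rewrite leq_addl addnK addnC subnDA.
Qed.

Lemma toep1 p : toep p 1 = 1%:M.
Proof.
apply/matrixP=> i j; rewrite !mxE coef1 -val_eqE /=.
by case: leqP => ij; rewrite ?subn_eq0 ?eqn_leq ?ij ?andbT // [(j <= i)%N]leqNgt ij andbF.
Qed.

Lemma toep_eq p f g : (forall i, (i < p)%N -> f`_i = g`_i) -> toep p f = toep p g.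
Proof.
move=> fg; apply/matrixP=> i j; rewrite !mxE; case: leqP => // _; apply: fg.
exact: leq_ltn_trans (leq_subr _ _) (ltn_ord i).
Qed.

Lemma toep_coef p f g i : toep p f = toep p g -> (i < p)%N -> f`_i = g`_i.
Proof.
move=> fg ip; have p0 : (0 < p)%N by apply: leq_ltn_trans ip.
by have /matrixP/(_ (Ordinal ip) (Ordinal p0)) := fg; rewrite !mxE subn0.
Qed.

Lemma toep_inverse_exists p f (f0 : f`_0 = 1) : exists g, toep p (f * g) = 1%:M.
Proof.
(* Truncated geometric series for [1/f]; the error [(1 - f) ^+ p] is divisible by [X^p] since
   [1 - f] has no constant term. *)
exists (\sum_(i < p) (1 - f) ^+ i).
have -> : f * \sum_(i < p) (1 - f) ^+ i = 1 - (1 - f) ^+ p.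
  rewrite -[RHS]opprB subrX1 -mulNr; congr (_ * _); ring.
have /factor_theorem[u ->] : root (1 - f) 0.
  by rewrite /root horner_coef0 coefB coef1 f0 subrr.
rewrite -toep1; apply: toep_eq => i ip; rewrite subr0 exprMn coefB coefMXn ip.
by rewrite subr0.
Qed.

Lemma tr_toep p f : \tr (toep p f) = p%:R * f`_0.
Proof.
rewrite /mxtrace (eq_bigr (fun=> f`_0)) => [|i _]; last by rewrite mxE leqnn subnn.
by rewrite sumr_const card_ord mulr_natl.
Qed.

Lemma sum_delta (p c : nat) (F : nat -> k) :
  \sum_(l < p) (l == c :> nat)%:R * F l = if (c < p)%N then F c else 0.
Proof.
case: ltnP => cp.
  rewrite (bigD1 (Ordinal cp)) //= eqxx mul1r big1 ?addr0 // => l lc.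
  by rewrite (_ : _ == _ = false) ?mul0r //; apply/negbTE.
apply: big1 => l _; rewrite (_ : _ == _ = false) ?mul0r //.
by apply/negbTE; rewrite neq_ltn (leq_trans (ltn_ord l) cp).
Qed.

(* Acting on columns, [shiftmx m p] divides by [X^m] and drops the negative powers. *)
Definition shiftmx (m p : nat) : 'M[k]_p :=
  \matrix_(a, b) (b == (a + m)%N :> nat)%:R.

Lemma mul_shiftmx_toep m p f (a b : 'I_p) :
  (shiftmx m p *m toep p f) a b =
  if (a + m < p)%N && (b <= a + m)%N then f`_(a + m - b) else 0.
Proof.
rewrite mxE; under eq_bigr do rewrite !mxE.
rewrite (sum_delta p (a + m) (fun l => if (b <= l)%N then f`_(l - b) else 0)).
by case: ltnP.
Qed.

Lemma tr_shiftmx_toep m s p f : p = (m + s)%N ->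
  \tr (shiftmx m p *m toep p f) = s%:R * f`_m.
Proof.
move=> ->.
rewrite /mxtrace (eq_bigr (fun a : 'I__ => if (a < s)%N then f`_m else 0)); last first.
  by move=> a _; rewrite mul_shiftmx_toep addnC ltn_add2l leq_addl andbT addnK.
by rewrite -big_mkcond (big_ord_narrow (leq_addl m s)) sumr_const card_ord mulr_natl.
Qed.

(** The [c_b] of the overview; it equals [s - |b - m|] when this is positive and 0 otherwise. *)
Definition shift_count (m s b : nat) : nat :=
  \sum_(a < s) \sum_(c < s) (c + m == a + b)%N.

(** For [a, c < s] the factors have entries [f_(a + m - c)] and [[c + m = a + b]], and the latter
    condition turns the index into [2 m - b]. The bound [s <= m] keeps [a + m - c] and [c + m - a]
    from truncating. *)
Lemma tr_shiftmx_toep2 m s p b f : p = (m + s)%N -> (s <= m)%N ->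
  \tr (shiftmx m p *m toep p f *m (shiftmx m p *m toep p 'X^b))
  = (shift_count m s b)%:R * f`_(2 * m - b).
Proof.
move=> -> sm; rewrite /mxtrace /shift_count natr_sum mulr_suml.
pose T a := \sum_(c < s) (c + m == a + b)%N%:R * f`_(2 * m - b).
rewrite (eq_bigr (fun a : 'I__ => if (a < s)%N then T a else 0)); last first.
  move=> a _; rewrite mxE.
  under eq_bigr => c _ do rewrite !mul_shiftmx_toep coefXn.
  case: (ltnP a s) => as_; last first.
    by rewrite big1 // => c _; rewrite ifF ?mul0r //; lia.
  rewrite (eq_bigr (fun c : 'I__ => if (c < s)%N then
    (c + m == a + b)%N%:R * f`_(2 * m - b) else 0)); last first.
    move=> c _; case: (ltnP c s) => cs; last first.
      by rewrite [X in _ * X]ifF ?mulr0 //; lia.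
    have -> : (a + m < m + s)%N by rewrite addnC ltn_add2l.
    have -> : (c + m < m + s)%N by rewrite addnC ltn_add2l.
    have -> : (c <= a + m)%N by rewrite (leq_trans (ltnW cs)) ?(leq_trans sm) ?leq_addl.
    have le_acm : (a <= c + m)%N.
      by rewrite (leq_trans (ltnW as_)) ?(leq_trans sm) ?leq_addl.
    rewrite le_acm /= mulrC; case: (eqVneq (c + m)%N (a + b)%N) => [e|ne].
      rewrite e addKn eqxx; congr (_ * f`_ _); lia.
    rewrite (_ : (_ == b) = false) ?mul0r //; apply: contra_neqF ne => /eqP <-.
    by rewrite subnKC.
  by rewrite -big_mkcond (big_ord_narrow (leq_addl m s)).
rewrite -big_mkcond (big_ord_narrow (leq_addl m s)).
by apply: eq_bigr => a _; rewrite natr_sum mulr_suml.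
Qed.

End Toeplitz.

Arguments toep {k} p f.
Arguments shiftmx {k} m p.

(** * The evaluation point and the inverse Hankel matrix *)

Section Point.

Variables (k : comNzRingType) (q s m p : nat).
Hypotheses (q0 : (0 < q)%N) (s0 : (0 < s)%N).
Hypotheses (mE : m = (q + s)%N) (pE : p = (m + s)%N).
Implicit Types f g w : {poly k}.

Definition trinom : {poly k} := 1 + 'X^q + 'X^m.

Local Notation h := trinom.
Local Notation L := (shiftmx m p).

(* The coefficients are read backwards, so that [hankel_poly] is a block of [toep d f]. *)
Definition hankel_poly (n d : nat) f : 'M[k]_n :=
  \matrix_(i, j) if (i + j < d)%N then f`_(d - (i + j).+1) else 0.

Definition last_rows : 'M[k]_(m, p) := \matrix_(i, a) (a == (p - i.+1)%N :> nat)%:R.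

Definition first_cols : 'M[k]_(p, m) := \matrix_(b, j) (b == j :> nat)%:R.

Local Notation G := last_rows.
Local Notation U := first_cols.

(** [G] takes the last [m] rows in reverse order, which turns constant diagonals into constant
    antidiagonals. *)
Lemma hankel_polyE f : hankel_poly m p f = G *m toep p f *m U.
Proof.
apply/matrixP=> i j; rewrite !mxE.
under eq_bigr => b _ do rewrite [U _ _]mxE mxE mulrC.
under eq_bigr => b _ do under eq_bigr => a _ do rewrite !mxE.
under eq_bigr => b _ do rewrite (sum_delta _ p (p - i.+1)
  (fun a => if (b <= a)%N then f`_(a - b) else 0)).
rewrite (sum_delta _ p j (fun b => if (p - i.+1 < p)%N then
  if (b <= p - i.+1)%N then f`_(p - i.+1 - b) else 0 else 0)).
have hi := ltn_ord i; have hj := ltn_ord j.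
have -> : (j < p)%N by lia.
have -> : (p - i.+1 < p)%N by lia.
have -> : (j <= p - i.+1)%N = (i + j < p)%N by lia.
by rewrite -subnDA addSn.
Qed.

(** Only coefficients of [h] of index strictly between [m - s = q] and [m + s] occur, and there [h]
    agrees with [X^m]. *)
Lemma shift_trinom : L *m toep p h *m L = L.
Proof.
apply/matrixP=> a b; rewrite mxE.
under eq_bigr => c _ do rewrite mul_shiftmx_toep !mxE mulrC.
have [mb|bm] := leqP m b; last first.
  by rewrite big1 => [|c _]; rewrite ?mxE (_ : _ == _ = false) ?mul0r //; lia.
have eb c : (b == (c + m)%N :> nat) = (c == (b - m)%N) by lia.
under eq_bigr => c _ do rewrite eb.
rewrite (sum_delta _ p (b - m) (fun c => if (a + m < p)%N && (c <= a + m)%N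
  then h`_(a + m - c) else 0)).
have bp := ltn_ord b; rewrite mxE ifT; last by lia.
have [as_|sa] := ltnP a s; last first.
  have -> : (a + m < p)%N = false by lia.
  by have -> : (b == (a + m)%N :> nat) = false by lia.
rewrite ifT; last by lia.
rewrite !coefD coef1 !coefXn.
have -> : (a + m - (b - m) == 0)%N = false by lia.
have -> : (a + m - (b - m) == q)%N = false by lia.
rewrite !add0r; congr (_%:R); lia.
Qed.

Lemma first_cols_proj : U *m U^T + L^T *m L = 1%:M.
Proof.
apply/matrixP=> a b; rewrite !mxE.
under eq_bigr do rewrite !mxE [(a == _ :> nat)]eq_sym.
under [X in _ + X]eq_bigr do rewrite !mxE.
rewrite (sum_delta _ m a (fun j => (b == j :> nat)%:R)).
have -> : (a == b) = (b == a :> nat) by rewrite eq_sym.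
have [am|ma] := ltnP a m.
  rewrite big1 ?addr0 // => l _; rewrite (_ : (a == _ :> nat) = false) ?mul0r //; lia.
have ea l : (a == (l + m)%N :> nat) = (l == (a - m)%N) by lia.
under eq_bigr do rewrite ea.
have ap := ltn_ord a.
rewrite (sum_delta _ p (a - m) (fun l => (b == (l + m)%N :> nat)%:R)) add0r.
have -> : (a - m < p)%N by lia.
by rewrite subnK.
Qed.

Lemma last_rows_proj : G^T *m G + L *m L^T = 1%:M.
Proof.
apply/matrixP=> a b; rewrite !mxE.
have ap := ltn_ord a; have bp := ltn_ord b.
under [X in _ + X]eq_bigr do rewrite !mxE.
rewrite (sum_delta _ p (a + m) (fun l => (l == (b + m)%N :> nat)%:R)) eqn_add2r.
rewrite (eq_bigr (fun i : 'I_m => (i == (p - a.+1)%N :> nat)%:R *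
    (b == (p - i.+1)%N :> nat)%:R)); last first.
  by move=> i _; have im := ltn_ord i; rewrite !mxE; congr (_%:R * _); lia.
rewrite (sum_delta _ m (p - a.+1) (fun i => (b == (p - i.+1)%N :> nat)%:R)).
rewrite -val_eqE /= (_ : (p - (p - a.+1).+1)%N = a); last by lia.
rewrite [in LHS]eq_sym.
have [am|ma] := ltnP (p - a.+1) m.
  by rewrite ifF ?addr0 //; lia.
by rewrite ifT ?add0r //; lia.
Qed.

Lemma last_rowsK : G *m G^T = 1%:M.
Proof.
apply/matrixP=> i j; rewrite !mxE.
have im := ltn_ord i; have jm := ltn_ord j.
under eq_bigr do rewrite !mxE.
rewrite (sum_delta _ p (p - i.+1) (fun a => (a == (p - j.+1)%N :> nat)%:R)).
by rewrite ifT; [rewrite -val_eqE /=; congr (_%:R); lia | lia].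
Qed.

Lemma last_rows_shift : G *m L = 0.
Proof.
apply/matrixP=> i b; rewrite !mxE.
have im := ltn_ord i; have bp := ltn_ord b.
under eq_bigr do rewrite !mxE.
rewrite (sum_delta _ p (p - i.+1) (fun a => (b == (a + m)%N :> nat)%:R)).
by case: ifP => // _; rewrite (_ : _ == _ = false) //; lia.
Qed.

Local Notation T := (toep p).

Definition hankel_inv : 'M[k]_m := U^T *m T h *m (1%:M - L *m T h) *m G^T.

Local Notation N := hankel_inv.

Lemma toepC f g : T f *m T g = T g *m T f.
Proof. by rewrite -!toepM mulrC. Qed.

(** By [shift_trinom], [L] kills [T h *m (1 - L *m T h)], whose last [s] rows therefore vanish. *)
Lemma proj_range : U *m U^T *m (T h *m (1%:M - L *m T h)) = T h *m (1%:M - L *m T h).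
Proof.
have -> : U *m U^T = 1%:M - L^T *m L by rewrite -first_cols_proj addrK.
rewrite mulmxBl mul1mx -[L^T *m L *m _]mulmxA (_ : L *m (T h *m _) = 0) ?mulmx0 ?subr0 //.
by rewrite !mulmxBr mulmx1 !mulmxA shift_trinom subrr.
Qed.

(** Dually, [1 - L *m T h] kills the image of [L], that is, the first [s] coordinates, which are
    those dropped by [G^T *m G]. *)
Lemma proj_kernel : (1%:M - L *m T h) *m (G^T *m G) = 1%:M - L *m T h.
Proof.
have -> : G^T *m G = 1%:M - L *m L^T by rewrite -last_rows_proj addrK.
rewrite mulmxBr mulmx1 mulmxA (_ : _ *m L = 0) ?mul0mx ?subr0 //.
by rewrite mulmxBl mul1mx shift_trinom subrr.
Qed.

Lemma hankel_polyK f : T (h * f) = 1%:M -> hankel_poly m p f *m N = 1%:M.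
Proof.
move=> hf; rewrite hankel_polyE /N -!mulmxA [T h *m _]mulmxA [U *m (U^T *m _)]mulmxA.
rewrite [U *m U^T *m _]mulmxA proj_range -mulmxA [T f *m _]mulmxA -toepM mulrC hf.
by rewrite mul1mx mulmxA mulmxBr mulmx1 mulmxA last_rows_shift mul0mx subr0 last_rowsK.
Qed.

(** Here [g] is [X^b/h^2] modulo [X^p]. Expanding both factors [1 - L *m T h] gives four traces; the
    two with a single [L] agree, hence the coefficient 2. *)
Lemma tr_hankel_inv f g b : T (h * h * g) = T 'X^b ->
  \tr (hankel_poly m p f *m N *m hankel_poly m p g *m N) =
  p%:R * (f * 'X^b)`_0 - 2 * (s%:R * (h * f * 'X^b)`_m) +
  (shift_count m s b)%:R * (h * h * f)`_(2 * m - b).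
Proof.
move=> hg; set P := 1%:M - L *m T h.
have Tg w w' : w' = w * (h * h * g) -> T w' = T (w * 'X^b).
  by move=> ->; rewrite toepM hg -toepM.
have hN w : hankel_poly m p w *m N = G *m (T (w * h) *m P) *m G^T.
  rewrite toepM hankel_polyE /N -!mulmxA [T h *m _]mulmxA [U *m (U^T *m _)]mulmxA.
  by rewrite [U *m U^T *m _]mulmxA proj_range !mulmxA.
(* Cyclicity of the trace brings each [G^T *m G] next to a [P], which absorbs it. *)
transitivity (\tr (T (f * h) *m P *m (T (g * h) *m P))).
  rewrite -mulmxA !hN -!mulmxA mxtrace_mulC -!mulmxA.
  by rewrite [G^T *m (G *m _)]mulmxA [P *m (G^T *m G *m _)]mulmxA !proj_kernel.
have -> : T (f * h) *m P *m (T (g * h) *m P) =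
    T (f * 'X^b) - T (f * h) *m (L *m T (h * (g * h)))
    - (T (f * h * (g * h)) *m (L *m T h)
       - T (f * h) *m (L *m T (h * (g * h)) *m (L *m T h))).
  rewrite /P !mulmxBr !mulmx1 !mulmxBl -[in RHS](Tg _ (f * h * (g * h))); last by ring.
  by rewrite !toepM !mulmxA.
have sm : (s <= m)%N by rewrite mE leq_addl.
rewrite !raddfB /= tr_toep.
have -> : \tr (T (f * h * (g * h)) *m (L *m T h)) = s%:R * (h * f * 'X^b)`_m.
  rewrite mxtrace_mulC -mulmxA -toepM (Tg (h * f)); last by ring.
  exact: tr_shiftmx_toep.
have -> : \tr (T (f * h) *m (L *m T (h * (g * h)))) = s%:R * (h * f * 'X^b)`_m.
  rewrite mxtrace_mulC -mulmxA -toepM (Tg (h * f)); last by ring.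
  exact: tr_shiftmx_toep.
have -> : \tr (T (f * h) *m (L *m T (h * (g * h)) *m (L *m T h))) =
    (shift_count m s b)%:R * (h * h * f)`_(2 * m - b).
  rewrite mxtrace_mulC -!mulmxA -toepM mulmxA mxtrace_mulC.
  rewrite (Tg 1 (h * (g * h))) ?mul1r; last by ring.
  by rewrite (tr_shiftmx_toep2 _ m s) // (_ : h * (f * h) = h * h * f) //; ring.
ring.
Qed.

End Point.

(** * The linear system satisfied by a kernel vector *)

Lemma coef_trinomM (k : comNzRingType) (q m : nat) (f : {poly k}) (j : nat) :
  (trinom k q m * f)`_j =
  f`_j + (if (j < q)%N then 0 else f`_(j - q))
       + (if (j < m)%N then 0 else f`_(j - m)).
Proof. by rewrite /trinom !mulrDl mul1r !coefD !coefXnM. Qed.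

Lemma shift_count0 (m s b : nat) : (b + s <= m)%N -> shift_count m s b = 0%N.
Proof.
move=> bm; apply: big1 => a _; apply: big1 => c _.
by apply/eqP; rewrite eqb0; apply/eqP; have := ltn_ord a; lia.
Qed.

Lemma shift_count_diag (m s : nat) : shift_count m s m = s.
Proof.
rewrite /shift_count (eq_bigr (fun=> 1%N)) ?sum1_card ?card_ord // => a _.
rewrite (bigD1 a) //= eqxx big1 ?addn0 // => c ca.
by rewrite eqn_add2r val_eqE (negPf ca).
Qed.

Lemma shift_count_gt0 (m s b : nat) :
  (m < b + s)%N -> (b < m + s)%N -> (0 < shift_count m s b)%N.
Proof.
move=> h1 h2; have aP : (m - b < s)%N by lia.
have cP : (b - m < s)%N by lia.
rewrite /shift_count (bigD1 (Ordinal aP)) //= (bigD1 (Ordinal cP)) //=.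
by rewrite (_ : (_ == _) = true) //; lia.
Qed.

(** With [g = h w] and [eta = h g], the equations for [0 < b <= q] give [g_j = 0] for [s <= j < m],
    and those for [m < b < p] give [eta_j = 0] for [q < j < m]. The cases [b = m] and [b = 0] then
    settle [g_m] and [g_0], and [q < b < m] the remaining [eta_j]. *)
Lemma trinom_system_trivial (k : fieldType) (hk : [pchar k] =i pred0)
    (q s m p : nat) (w : {poly k}) :
  (0 < q)%N -> (0 < s)%N -> m = (q + s)%N -> p = (m + s)%N ->
  (forall b, (b < p)%N ->
    p%:R * (w * 'X^b)`_0 - 2 * (s%:R * (trinom k q m * w * 'X^b)`_m)
    + (shift_count m s b)%:R * (trinom k q m * trinom k q m * w)`_(2 * m - b) = 0) ->
  forall j, (j < p)%N -> (trinom k q m * trinom k q m * w)`_j = 0.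
Proof.
move=> q0 s0 mE pE; set h := trinom k q m; set g := h * w.
rewrite -mulrA -/g; set eta := h * g => sys.
have nz n : (0 < n)%N -> n%:R != 0 :> k by rewrite (pcharf0P k).1 // lt0n.
have gw : g`_0 = w`_0.
  by rewrite coef_trinomM q0 !addr0 ifT ?addr0 //; lia.
have sys0 b : (0 < b < m)%N ->
    2 * (s%:R * g`_(m - b)) = (shift_count m s b)%:R * eta`_(2 * m - b).
  move=> /andP[b0 bm]; have := sys b ltac:(lia).
  rewrite !coefMXn b0 mulr0 sub0r ltnNge (ltnW bm) /=.
  by move=> /eqP; rewrite addrC subr_eq0 => /eqP.
have g_top j : (s <= j < m)%N -> g`_j = 0.
  move=> /andP[sj jm]; have := sys0 (m - j)%N ltac:(lia).
  rewrite shift_count0 ?mul0r ?subKn ?(ltnW jm) //; last by lia.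
  by move=> /eqP; rewrite !mulf_eq0 !(negPf (nz _ _)) // => /eqP.
have eta_mid j : (q < j < m)%N -> eta`_j = 0.
  move=> /andP[qj jm]; have := sys (2 * m - j)%N ltac:(lia).
  rewrite !coefMXn !ifT ?mulr0 ?subrr ?add0r ?subKn; try lia.
  by move=> /eqP; rewrite mulf_eq0 (negPf (nz _ _)) ?shift_count_gt0 //; [move/eqP|lia|lia].
(* Descending induction through [eta_(j + q) = g_(j + q) + g_j]; this is what the term [X^q] of [h]
   is for. *)
have g_mid j : (0 < j < m)%N -> g`_j = 0.
  have [n] := ubnP (m - j); elim: n j => // n IHn j mjn /andP[j0 jm].
  have [sj|js] := leqP s j; first by apply: g_top; rewrite sj.
  have jqm : (j + q < m)%N by lia.
  have := eta_mid (j + q)%N ltac:(lia); rewrite coef_trinomM jqm.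
  by rewrite ltnNge leq_addl /= addnK addr0 IHn ?add0r //; lia.
have eta_m : eta`_m = g`_m + g`_0.
  rewrite coef_trinomM ltnn subnn ifF; last by lia.
  by rewrite (g_mid (m - q)%N) ?addr0 //; lia.
have gm : g`_m = g`_0.
  have := sys m ltac:(lia); rewrite !coefMXn ltnn subnn shift_count_diag.
  have -> : (0 < m)%N by lia.
  rewrite (_ : (2 * m - m)%N = m) ?eta_m; last by lia.
  rewrite (_ : _ + _ = s%:R * (g`_m - g`_0)); last by ring.
  by move/eqP; rewrite mulf_eq0 (negPf (nz _ s0)) subr_eq0 => /eqP.
have g0 : g`_0 = 0.
  have := sys 0%N ltac:(lia); rewrite !coefMXn /= !subn0 shift_count0; last by lia.
  (* The equation for [b = 0] is now [(p - 2 s) g_0 = 0], with [p - 2 s = q > 0]. *)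
  rewrite gm -gw (_ : p = q + 2 * s)%N; last by lia.
  rewrite natrD natrM (_ : _ + _ = q%:R * g`_0); last by ring.
  by move/eqP; rewrite mulf_eq0 (negPf (nz _ q0)) => /eqP.
have g_low j : (j < m)%N -> g`_j = 0.
  by case: j => [|j] jm; rewrite ?g0 // g_mid.
move=> j jp; have [jm|jm|->] := ltngtP j m; last by rewrite eta_m gm g0 addr0.
  rewrite coef_trinomM jm g_low // !add0r addr0.
  by case: ifP => // _; rewrite g_low //; lia.
have := sys0 (2 * m - j)%N ltac:(lia); rewrite g_low; last by lia.
rewrite !mulr0 subKn; last by lia.
move/esym/eqP; rewrite mulf_eq0 (negPf (nz _ _)); first by move/eqP.
by apply: shift_count_gt0; lia.
Qed.

(** * The Hessian of the Hankel determinant *)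

Lemma mderiv_var (k : comNzRingType) (n : nat) (i l : 'I_n) :
  mderiv i ('X_l : {mpoly k[n]}) = (l == i)%:R.
Proof.
rewrite mderivX mnm1E; case: eqP => [->|_]; last by rewrite scale0r.
by rewrite -{1}[U_(i)%MM]add0m addmK mpolyX0 scale1r.
Qed.

Section Assembly.

Variables (k : fieldType) (m p : nat).

Definition rev_poly (x : 'I_p -> k) : {poly k} := \sum_l x l *: 'X^(p - l.+1).

Lemma coef_rev_poly x (c : 'I_p) : (rev_poly x)`_(p - c.+1) = x c.
Proof.
rewrite coef_sum (bigD1 c) //= coefZ coefXn eqxx mulr1 big1 ?addr0 // => l lc.
rewrite coefZ coefXn (_ : (_ == _) = false) ?mulr0 //; apply/negbTE.
apply: contraNneq lc => e; apply/eqP/val_inj => /=.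
by have := ltn_ord l; have := ltn_ord c; lia.
Qed.

Lemma toep_rev_poly (f : {poly k}) :
  toep p (rev_poly (fun l => f`_(p - l.+1))) = toep p f.
Proof.
apply: toep_eq => i ip; have cP : (p - i.+1 < p)%N by lia.
have := coef_rev_poly (fun l => f`_(p - l.+1)) (Ordinal cP) => /=.
by rewrite (_ : (p - (p - i.+1).+1)%N = i) //; lia.
Qed.

Lemma hankel_poly_rev_poly x :
  hankel_poly k m p (rev_poly x) = \sum_l x l *: hankel_poly k m p 'X^(p - l.+1).
Proof.
apply/matrixP=> i j; rewrite summxE mxE.
under eq_bigr do rewrite !mxE; case: ifP => _; last first.
  by rewrite big1 // => l _; rewrite mulr0.
by rewrite coef_sum; apply: eq_bigr => l _; rewrite coefZ.
Qed.

(** The number [p] of variables is a free parameter, so that no truncated subtraction appears in the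
    type; [hankel k m r] is the instance [p = 2 * m - r - 1]. *)
Definition hankel_mpoly : 'M[{mpoly k[p]}]_m :=
  \matrix_(i, j) if insub (i + j)%N is Some l then 'X_(l : 'I_p) else 0.

Lemma mderiv_hankel_mpoly (l : 'I_p) :
  map_mx (mderiv l) hankel_mpoly =
  map_mx (@mpolyC p k) (hankel_poly k m p 'X^(p - l.+1)).
Proof.
apply/matrixP=> i j; rewrite !mxE; case: insubP => [c ijp /= cE|/negbTE ->].
  rewrite ijp mderiv_var coefXn -val_eqE -cE /= rmorph_nat; congr _%:R.
  by have := ltn_ord l; have := ltn_ord c; lia.
by rewrite mderiv0 mpolyC0.
Qed.

Lemma meval_hankel_mpoly (v : 'I_p -> k) :
  map_mx (meval v) hankel_mpoly = hankel_poly k m p (rev_poly v).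
Proof.
apply/matrixP=> i j; rewrite !mxE; case: insubP => [c ijp /= cE|/negbTE ->].
  by rewrite ijp mevalXU -cE coef_rev_poly.
by rewrite raddf0.
Qed.

Lemma meval_second_mderiv_det (v : 'I_p -> k) (i j : 'I_p) :
  let A := hankel_poly k m p (rev_poly v) in
  let B (l : 'I_p) := hankel_poly k m p 'X^(p - l.+1) in
  \det A * (mderiv i (mderiv j (\det hankel_mpoly))).@[v] =
  \tr (B i *m \adj A) * \tr (B j *m \adj A)
  - \tr (B i *m \adj A *m B j *m \adj A).
Proof.
move=> A B.
have mapC (M : 'M[k]_m) : map_mx (meval v) (map_mx (@mpolyC p k) M) = M.
  by apply/matrixP=> a b; rewrite !mxE mevalC.
have dd : map_mx (mderiv i) (map_mx (mderiv j) hankel_mpoly) = 0.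
  by rewrite mderiv_hankel_mpoly; apply/matrixP=> a b; rewrite !mxE mderivC.
have := congr1 (meval v) (det_second_derivation _ _ _ (mderivM i) (mderivM j) _ _ dd).
rewrite mevalB !mevalM !derivation_det; try exact: mderivM.
rewrite -!trace_map_mx !map_mxM !map_mx_adj !mderiv_hankel_mpoly !mapC.
rewrite -det_map_mx meval_hankel_mpoly -/A -/(B i) -/(B j) => ->.
by congr (_ - _); rewrite -[B j *m _ *m B i *m _]mulmxA mxtrace_mulC mulmxA.
Qed.

End Assembly.

Lemma hessian_hankel_neq0 (k : fieldType) (hk : [pchar k] =i pred0)
    (q s m p : nat) (q0 : (0 < q)%N) (s0 : (0 < s)%N)
    (mE : m = (q + s)%N) (pE : p = (m + s)%N) :
  hessian (\det (hankel_mpoly k m p)) <> 0.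
Proof.
set h := trinom k q m.
have h0 : h`_0 = 1.
  by rewrite /h -[trinom _ _ _]mulr1 coef_trinomM coef1 q0 ifT ?addr0 //; lia.
have [E hE] := toep_inverse_exists k p h h0.
(* The evaluation point: [rev_poly] sends [v] back to [E], which is [1/h] modulo [X^p]. *)
pose v (l : 'I_p) := E`_(p - l.+1) : k.
pose H := map_mx (meval v) (\matrix_(i, j)
  mderiv i (mderiv j (\det (hankel_mpoly k m p)))).
move=> hess0; have : \det H == 0.
  by rewrite det_map_mx -[\det _]/(hessian _) hess0 raddf0.
(* [det0P] yields a left kernel vector, hence the transpose; it remains to show [w = 0]. *)
rewrite -det_tr => /det0P[w w0 Hw]; move/negP: w0; apply; apply/eqP.
pose B (l : 'I_p) := hankel_poly k m p 'X^(p - l.+1).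
have TE : toep p (h * rev_poly _ _ v) = 1%:M by rewrite toepM toep_rev_poly -toepM.
have AN := hankel_polyK k q s m p q0 s0 mE pE _ TE.
set N := hankel_inv k q m p in AN.
have ker : forall i, \tr (B i *m N *m (\sum_l w 0 l *: B l) *m N) = 0.
  apply: (hessian_form_kernel k hk m p B H N v (fun l => w 0 l)).
  - by rewrite -hankel_poly_rev_poly.
  - lia.
  - by move=> i j; rewrite -hankel_poly_rev_poly mxE mxE meval_second_mderiv_det.
  - move=> i; transitivity ((w *m H^T) 0 i); last by rewrite Hw mxE.
    by rewrite mxE; apply: eq_bigr => j _; rewrite !mxE mulrC.
rewrite -hankel_poly_rev_poly in ker; set W := rev_poly _ _ _ in ker.
(* The matrices [B l] span all Hankel blocks, so the kernel relations extend to every test series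
   [g]. *)
have kerg g : \tr (hankel_poly k m p W *m N *m hankel_poly k m p g *m N) = 0.
  have -> : hankel_poly k m p g = \sum_l g`_(p - (l : 'I_p).+1) *: B l.
    rewrite -(hankel_poly_rev_poly _ _ _ (fun l => g`_(p - l.+1))).
    by rewrite !(hankel_polyE k q s m p) // toep_rev_poly.
  rewrite mulmx_sumr mulmx_suml raddf_sum big1 // => l _.
  rewrite -scalemxAr -scalemxAl [LHS]mxtraceZ -[X in \tr X]mulmxA mxtrace_mulC.
  by rewrite mulmxA ker mulr0.
have eta0 := trinom_system_trivial k hk q s m p W q0 s0 mE pE.
have {}eta0 : forall j, (j < p)%N -> (h * h * W)`_j = 0.
  apply: eta0 => b bp; rewrite -(tr_hankel_inv k q s m p q0 s0 mE pE _ (E * E * 'X^b)) ?kerg //.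
  rewrite (_ : _ * _ = h * E * (h * E) * 'X^b); last by rewrite -/h; ring.
  by rewrite toepM [toep p (h * E * _)]toepM hE !mul1mx.
(* Multiplying [h^2 W = 0] by [E^2] recovers [W = 0] modulo [X^p]. *)
have W0 : toep p W = toep p 0.
  have -> : toep p W = toep p (h * E) *m toep p (h * E) *m toep p W.
    by rewrite hE !mul1mx.
  rewrite -!toepM (_ : _ * W = E * E * (h * h * W)); last by ring.
  rewrite toepM (toep_eq _ p (h * h * W) 0); first by rewrite -toepM mulr0.
  by move=> j /eta0 ->; rewrite coef0.
apply/rowP=> l; rewrite mxE -(coef_rev_poly _ _ (fun l => w 0 l)) -/W.
rewrite (toep_coef _ p W 0) ?coef0 //; have := ltn_ord l; lia.
Qed.

Theorem theorem3p1 (k : fieldType) (m r : nat)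
    (hk : [pchar k] =i pred0) (hr : (r + 2 <= m)%N) :
  hessian (\det (hankel k m r)) <> 0.
Proof.
by apply: (hessian_hankel_neq0 k hk r.+1 (m - r.+1)); lia.
Qed.
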